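(* Let $S\subseteq\mathbb{N}^{\mathbb{N}}$. Then $S$ is $\boldsymbol{\Delta}^0_2$ if and only if $S_{\infty}=\emptyset$.
   Context: $\mathbb{N}^{\mathbb{N}}$ is Baire space (all functions $f:\mathbb{N}\to\mathbb{N}$, with the product topology of the discrete topology), and $\boldsymbol{\Delta}^0_2$ is the boldface Borel pointclass of subsets of $\mathbb{N}^{\mathbb{N}}$ that are both $F_\sigma$ and $G_\delta$. $\mathbb{N}^{<\mathbb{N}}$ is the set of finite sequences of natural numbers (including the empty sequence). For sequences $x,y$ (finite or infinite), $x\subseteq y$ means that $x$ is an initial segment of $y$. For $X\subseteq\mathbb{N}^{<\mathbb{N}}$, $[X]\subseteq\mathbb{N}^{\mathbb{N}}$ denotes the set of infinite sequences all of whose finite initial segments are in $X$. For $S\subseteq\mathbb{N}^{\mathbb{N}}$, define $S_{\alpha}\subseteq\mathbb{N}^{<\mathbb{N}}$ for every ordinal $\alpha$ by transfinite recursion: $S_0=\mathbb{N}^{<\mathbb{N}}$; $S_{\lambda}=\bigcap_{\beta<\lambda}S_{\beta}$ for every limit ordinal $\lambda$ (that is, $\lambda$ nonzero and not a successor); and for every ordinal $\beta$, $$S_{\beta+1}=\{x\in S_{\beta} : \text{there exist } x',x''\in[S_{\beta}] \text{ such that } x\subseteq x',\ x\subseteq x'',\ x'\in S,\ \text{and } x''\notin S\}.$$ Let $\alpha(S)$ be the least ordinal $\alpha$ such that $S_{\alpha}=S_{\alpha+1}$, and let $S_{\infty}=S_{\alpha(S)}$. *)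

(* Defs.v *)
From HB Require Import structures.
From mathcomp Require Import all_boot all_order generic_quotient.
From mathcomp Require Import boolp classical_sets.
From mathcomp Require Import topology borel_hierarchy.

Set Implicit Arguments.
Unset Strict Implicit.
Unset Printing Implicit Defensive.

Import Order.TTheory.

Local Open Scope classical_set_scope.
Local Open Scope quotient_scope.

(* Ordinals. The tree [OSup f] names the least ordinal strictly above all the
   ordinals named by the [f a], so every well-founded tree names an ordinal (its
   rank), and [Ord] below identifies the trees that name the same one. The
   result is a totally ordered ([Ord] is an [orderType]), well-founded
   ([Ord_lt_wf]) class in which every small family has a least strict upper
   bound ([ssupP]).

   Universes: index types must be strictly smaller than [Ord], so an index type
   built from sets of finite sequences should mention [seq nat -> Prop] rather
   than [set (seq nat)], since [set] is not universe polymorphic. *)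
Inductive otree : Type := OSup (A : Type) (f : A -> otree).

Fixpoint ole (x y : otree) : Prop :=
  match x, y with
  | OSup A f, OSup B g => forall a : A, exists b : B, ole (f a) (g b)
  end.

Definition olt (x y : otree) : Prop :=
  match y with OSup B g => exists b : B, ole x (g b) end.

Lemma ole_refl x : ole x x.
Proof. by elim: x => A f IH /= a; exists a. Qed.

Lemma ole_trans x y z : ole x y -> ole y z -> ole x z.
Proof.
elim: x y z => A f IH [B g] [C h] /= xy yz a.
have [b ab] := xy a; have [c bc] := yz b.
by exists c; exact: (IH _ _ _ ab bc).
Qed.

Lemma oleP (A : Type) (f : A -> otree) y :
  ole (OSup f) y <-> forall a, olt (f a) y.
Proof. by case: y. Qed.

Lemma olt_ole_trans x y z : olt x y -> ole y z -> olt x z.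
Proof.
case: y z => B g [C h] /= [b xb] yz; have [c bc] := yz b.
by exists c; exact: (ole_trans xb bc).
Qed.

Lemma ole_total x y : ~ ole x y -> olt y x.
Proof.
elim: x y => A f IH [B g] /= /existsNP[a na]; exists a.
by apply/oleP => b; apply: IH => fg; apply: na; exists b.
Qed.

Lemma olt_wf : well_founded olt.
Proof.
move=> x; suff: forall y, ole y x -> Acc olt y by apply; exact: ole_refl.
elim: x => A f IH y yx; constructor => z zy.
by have [a za] := olt_ole_trans zy yx; exact: (IH _ _ za).
Qed.

Lemma olt_nle x y : olt x y -> ~ ole y x.
Proof.
elim/(well_founded_ind olt_wf): x y => x IH [B g] [b xb] yx.
have gx : olt (g b) x by move/oleP: yx; exact.
exact: (IH _ gx _ gx xb).
Qed.

Lemma olt_ole x y : olt x y -> ole x y.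
Proof.
elim: x y => A f IH [B g] [b xb] a; exists b; apply: IH.
by move/oleP: xb; exact.
Qed.

HB.instance Definition _ := gen_eqMixin otree.
HB.instance Definition _ := gen_choiceMixin otree.

Definition oeq (x y : otree) : bool := `[< ole x y /\ ole y x >].

Lemma oeq_refl : reflexive oeq.
Proof. by move=> x; apply/asboolP; split; exact: ole_refl. Qed.

Lemma oeq_sym : symmetric oeq.
Proof. by move=> x y; apply/asboolP/asboolP => -[]. Qed.

Lemma oeq_trans : transitive oeq.
Proof.
move=> y x z /asboolP[xy yx] /asboolP[yz zy]; apply/asboolP.
by split; [exact: ole_trans xy yz | exact: ole_trans zy yx].
Qed.

Canonical oeq_equiv := EquivRel oeq oeq_refl oeq_sym oeq_trans.

Definition Ord := {eq_quot oeq}.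

HB.instance Definition _ := Choice.on Ord.
HB.instance Definition _ := EqQuotient.on Ord.

Definition Ord_le (a b : Ord) : bool :=
  `[< ole (repr a) (repr b) >].

Lemma Ord_le_refl : reflexive Ord_le.
Proof. by move=> a; apply/asboolP; exact: ole_refl. Qed.

Lemma Ord_le_anti : antisymmetric Ord_le.
Proof.
move=> a b /andP[/asboolP ab /asboolP ba].
rewrite -[LHS]reprK -[RHS]reprK; apply/eqquotP.
exact/asboolP.
Qed.

Lemma Ord_le_trans : transitive Ord_le.
Proof.
by move=> b a c /asboolP ab /asboolP bc; apply/asboolP; exact: ole_trans ab bc.
Qed.

Lemma Ord_le_total : total Ord_le.
Proof.
move=> a b; apply/orP.
have [ab|/ole_total ba] := pselect (ole (repr a) (repr b)).
  by left; apply/asboolP.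
by right; apply/asboolP; exact: olt_ole.
Qed.

Fact Ord_display : Order.disp_t. Proof. exact: (Order.Disp tt tt). Qed.

HB.instance Definition _ :=
  Order.Le_isPOrder.Build Ord_display Ord Ord_le_refl Ord_le_anti Ord_le_trans.
HB.instance Definition _ :=
  Order.POrder_isTotal.Build Ord_display Ord Ord_le_total.

Lemma Ord_ltP (a b : Ord) :
  (a < b)%O <->
  olt (repr a) (repr b).
Proof.
rewrite ltNge; split => [/asboolP/ole_total//|ab].
by apply/asboolP; exact: olt_nle.
Qed.

Lemma Ord_lt_wf : well_founded (fun a b : Ord => (a < b)%O).
Proof.
move=> a; have [t] : exists t, t = repr a by eexists.
elim/(well_founded_ind olt_wf): t a => t IH a ta.
constructor => b /Ord_ltP ba; apply: IH erefl; by rewrite ta.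
Qed.

Definition ssup (A : Type) (f : A -> Ord) : Ord :=
  \pi_Ord (OSup (fun a => repr (f a))).

Lemma ssupP (A : Type) (f : A -> Ord) (b : Ord) :
  (ssup f <= b)%O <-> forall a, (f a < b)%O.
Proof.
have /asboolP[pr rp] : oeq (repr (ssup f))
    (OSup (fun a => repr (f a))).
  by apply/eqquotP; exact: (@reprK _ Ord (ssup f)).
split=> [/asboolP sb a|fb].
  by apply/Ord_ltP; move/oleP: (ole_trans rp sb); exact.
by apply/asboolP; apply: ole_trans pr _; apply/oleP => a; exact/Ord_ltP.
Qed.

Definition ozero : Ord := ssup (fun e : False => match e with end).
Definition osucc (a : Ord) : Ord := ssup (fun _ : unit => a).

Lemma le_ozero (a : Ord) : (ozero <= a)%O.
Proof. by apply/ssupP. Qed.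

Lemma osucc_le (a b : Ord) : (osucc a <= b)%O = (a < b)%O.
Proof. by apply/idP/idP => [/ssupP/(_ tt)//|ab]; apply/ssupP. Qed.

Lemma lt_osucc (a : Ord) : (a < osucc a)%O.
Proof. by rewrite -osucc_le. Qed.

Lemma osucc_inj : injective osucc.
Proof.
suff le a b : osucc a = osucc b -> (a <= b)%O.
  by move=> a b ab; apply/le_anti; rewrite !le.
by move=> ab; rewrite leNgt -osucc_le -ab -ltNge lt_osucc.
Qed.

Definition is_olimit (l : Ord) : Prop :=
  l <> ozero /\ ~ exists b, l = osucc b.

Lemma least_Ord (P : Ord -> Prop) :
  (exists a, P a) -> exists a, P a /\ forall b, P b -> (a <= b)%O.
Proof.
move=> [a]; elim/(well_founded_ind Ord_lt_wf): a => a IH Pa.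
case: (pselect (exists2 b, P b & (b < a)%O)) => [[b Pb ba]|n].
  exact: (IH _ ba Pb).
exists a; split => // b Pb; rewrite leNgt; apply/negP => ba.
by apply: n; exists b.
Qed.

(* The library's topology on [nat] is the discrete one. *)
Definition baire := prod_topology (fun _ : nat => nat).
HB.instance Definition _ := Topological.on baire.

Definition Delta02 (S : set baire) : Prop := Fsigma S /\ Gdelta S.

Definition initseg (x : seq nat) (f : baire) : Prop := x = mkseq f (size x).

Definition branches (X : set (seq nat)) : set baire :=
  [set f | forall x, initseg x f -> X x].

Section Stages.
Variable S : set baire.

Definition deriv (X : set (seq nat)) : set (seq nat) :=
  [set x | X x /\ exists f g : baire,
     [/\ branches X f, branches X g, initseg x f, initseg x g & S f /\ ~ S g]].

(* The three clauses of the recursion defining [stage], with [rec] the stages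
   below [a]; see [stage0], [stage_succ] and [stage_limit]. *)
Definition stage_step (a : Ord)
    (rec : forall b : Ord, (b < a)%O -> set (seq nat)) : set (seq nat) :=
  if a == ozero then setT
  else match pselect (exists b, a = osucc b) with
  | left h => let: exist b ab := cid h in
      deriv (rec b (eq_ind_r (fun c => (b < c)%O) (lt_osucc b) ab))
  | right _ => [set x | forall b (ba : (b < a)%O), rec b ba x]
  end.

Definition stage : Ord -> set (seq nat) := Fix Ord_lt_wf _ stage_step.

Lemma stageE a : stage a = stage_step (fun b (_ : (b < a)%O) => stage b).
Proof.
apply: (Fix_eq Ord_lt_wf (fun=> set (seq nat)) stage_step) => {}a f g fg.
congr (stage_step _); apply: functional_extensionality_dep => b.
by apply: functional_extensionality_dep => ba; exact: fg.
Qed.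

Lemma stage0 : stage ozero = setT.
Proof. by rewrite stageE /stage_step eqxx. Qed.

Lemma stage_succ b : stage (osucc b) = deriv (stage b).
Proof.
rewrite stageE /stage_step; case: eqP => [s0|_].
  by have := lt_osucc b; rewrite s0 ltNge le_ozero.
case: (pselect (exists c, osucc b = osucc c)) => [h|[]]; last by exists b.
by case: (cid h) => c bc /=; rewrite (osucc_inj bc).
Qed.

Lemma stage_limit l : is_olimit l ->
  stage l = [set x | forall b, (b < l)%O -> stage b x].
Proof.
move=> [l0 ls]; rewrite stageE /stage_step.
by case: eqP => // _; case: pselect.
Qed.

Lemma deriv_sub X : deriv X `<=` X.
Proof. by move=> x []. Qed.

Lemma stage_anti a b : (a <= b)%O -> stage b `<=` stage a.
Proof.
elim/(well_founded_ind Ord_lt_wf): b a => b IH a.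
rewrite le_eqVlt => /predU1P[->//|ab].
case: (pselect (b = ozero)) => [b0|b0].
  by move: ab; rewrite b0 ltNge le_ozero.
case: (pselect (exists c, b = osucc c)) => [[c bc]|bs].
  rewrite bc stage_succ; apply: subset_trans (@deriv_sub _) _.
  apply: IH; first by rewrite bc lt_osucc.
  by rewrite leNgt -osucc_le -bc -ltNge.
by rewrite stage_limit// => x; exact.
Qed.

Lemma stage_stabilizes : exists a, stage a = stage (osucc a).
Proof.
pose I := {X : seq nat -> Prop | exists a, X = stage a}.
pose f (i : I) : Ord := projT1 (cid (projT2 i)).
have fE (i : I) : sval i = stage (f i) by rewrite /f; case: cid.
exists (ssup f); rewrite eqEsubset; split; last exact/stage_anti/ltW/lt_osucc.
pose i : I := exist _ (stage (osucc (ssup f))) (ex_intro _ _ erefl).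
rewrite -[X in _ `<=` X]/(sval i) fE; apply: stage_anti.
by apply: ltW; apply/ssupP: i.
Qed.

Definition alpha : Ord := projT1 (cid (least_Ord stage_stabilizes)).

Lemma alphaP : stage alpha = stage (osucc alpha) /\
  forall b, stage b = stage (osucc b) -> (alpha <= b)%O.
Proof. by rewrite /alpha; case: cid. Qed.

Definition S_infty : set (seq nat) := stage alpha.

End Stages.

(* Main.v *)
Require Import Defs.
From mathcomp Require Import all_boot all_order.
From mathcomp Require Import boolp classical_sets topology borel_hierarchy.

(** If [S_infty] is nonempty, it equals its own derivative, so [S] and its
    complement are both dense in its set of branches.  When both are G_delta, a
    Baire category construction yields a point lying in [S] and outside [S].

    If [S_infty] is empty, each finite sequence [x] lies in a last stage [X_x].
    Along a branch [f], choose [x] so that [X_x] is as small as possible; then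
    [f] is a branch of [X_x].  As [x] is not in the derivative of [X_x], all the
    branches of [X_x] through [x] lie on the same side of [S].  Hence [S] and
    its complement are countable unions of the closed sets [N_x `&` [X_x]]. *)

Import Order.TTheory.

Local Open Scope classical_set_scope.

Lemma initsegP (x : seq nat) (f : baire) :
  initseg x f <-> forall i, (i < size x)%N -> nth 0%N x i = f i.
Proof.
rewrite /initseg; split=> [xf i ix|xf]; first by rewrite xf nth_mkseq.
apply: (@eq_from_nth _ 0%N) => [|i ix]; first by rewrite size_mkseq.
by rewrite nth_mkseq// xf.
Qed.

Lemma initseg_mkseq (f : baire) (n : nat) : initseg (mkseq f n) f.
Proof. by rewrite /initseg size_mkseq. Qed.

Lemma initseg_prefix_mkseq (x : seq nat) (f : baire) (n : nat) :
  initseg x f -> (size x <= n)%N -> prefix x (mkseq f n).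
Proof.
by move=> xf xn; rewrite prefixE -map_take take_iota (minn_idPl xn) [eqbRHS]xf.
Qed.

Lemma initseg_mkseq_anti (f : baire) (m n : nat) : (m <= n)%N ->
  initseg (mkseq f n) `<=` (initseg (mkseq f m) : set baire).
Proof.
move=> mn g; rewrite !initsegP !size_mkseq => fg i im.
by rewrite -fg ?nth_mkseq// (leq_trans im mn).
Qed.

Lemma open_initseg (x : seq nat) : open (initseg x : set baire).
Proof.
rewrite openE => f /initsegP xf.
have : nbhs f [set g : baire | forall i : 'I_(size x), g i = nth 0%N x i].
  apply: (@filter_forall baire _
    (fun (i : 'I_(size x)) g => g i = nth 0%N x i) (nbhs f)) => i.
  apply: (@proj_continuous nat (fun=> nat) i f [set nth 0%N x i]).
  by rewrite xf//; exact: discrete_set1.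
by apply: filterS => g xg; apply/initsegP => i ix; rewrite -(xg (Ordinal ix)).
Qed.

(** The filter generated by the cylinders around [f] converges to [f] coordinate by coordinate,
    because a cylinder of length [i.+1] fixes coordinate [i]. *)
Lemma nbhs_initseg (f : baire) (U : set baire) :
  nbhs f U -> exists n, initseg (mkseq f n) `<=` U.
Proof.
pose B n : set baire := initseg (mkseq f n).
have FF : Filter (filter_from setT B).
  apply: filter_from_filter; first by exists 0%N.
  move=> i j _ _; exists (maxn i j) => // g fg.
  by split; apply: initseg_mkseq_anti fg; rewrite leq_max leqnn ?orbT.
have Ff : filter_from setT B --> f.
  apply/cvg_sup => i A [_ [[V _ <-] Vf VA]].
  exists i.+1 => // g /initsegP /(_ i); rewrite size_mkseq => /(_ (ltnSn _)).
  by rewrite nth_mkseq// => fg; apply: VA; rewrite /= -fg.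
by move=> /Ff[n _ nU]; exists n.
Qed.

Lemma closed_branches (X : set (seq nat)) : closed (branches X).
Proof.
rewrite -[branches X]setCK; apply: open_closedC.
rewrite openE => f /existsNP[x /not_implyP[xf nX]].
apply: (@filterS _ _ _ (initseg x)); first by move=> g xg /(_ x xg).
by apply: open_nbhs_nbhs; split=> //; exact: open_initseg.
Qed.

Lemma closed_initseg (x : seq nat) : closed (initseg x : set baire).
Proof.
rewrite -[initseg x]setCK; apply: open_closedC.
rewrite openE => f nxf.
apply: (@filterS _ _ _ (initseg (mkseq f (size x)))); last first.
  apply: open_nbhs_nbhs; split; [exact: open_initseg|exact: initseg_mkseq].
move=> g; rewrite /initseg size_mkseq => fg xg.
  by apply: nxf; rewrite /initseg fg.
Qed.

(** Baire category on the branches of [X], where each [U n] is dense: from a node of [X], pass to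
    longer and longer nodes, the [n]-th extension having its cylinder inside [U n]. The limit of
    these nodes lies in every [U n]. *)
Lemma baire_branches (X : set (seq nat)) (U : nat -> set baire) :
    (forall n, open (U n)) ->
    (forall n x, X x -> exists f, [/\ branches X f, initseg x f & U n f]) ->
    X !=set0 ->
  \bigcap_n U n !=set0.
Proof.
move=> oU dU [x0 Xx0].
(* The premise [X p.2] sits under the existential so that [choice] yields a total function; off [X]
   its value is arbitrary. *)
have step (p : nat * seq nat) : exists y, X p.2 ->
    [/\ X y, prefix p.2 y, (size p.2 < size y)%N & initseg y `<=` U p.1].
  have [Xp|nXp] := pselect (X p.2); last by exists [::].
  have [f [Xf pf Uf]] := dU p.1 p.2 Xp.
  have [n nU] : exists n, initseg (mkseq f n) `<=` U p.1.
    by apply: nbhs_initseg; apply: open_nbhs_nbhs.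
  exists (mkseq f (maxn n (size p.2).+1)) => _; split.
  - exact/Xf/initseg_mkseq.
  - by apply: initseg_prefix_mkseq => //; rewrite leq_max leqnSn orbT.
  - by rewrite size_mkseq leq_max leqnn orbT.
  - by apply: subset_trans nU; apply: initseg_mkseq_anti; rewrite leq_max leqnn.
have [F FP] := choice step.
pose s := fix s n := if n is m.+1 then F (m, s m) else x0.
have Xs n : X (s n) by elim: n => //= n /(FP (n, _))[].
have ss n : (n <= size (s n))%N.
  elim: n => //= n.
  by have [_ _ /(leq_ltn_trans _) + _] := FP (n, _) (Xs n); exact.
have sp : {homo s : m n / (m <= n)%N >-> prefix m n}.
  apply: homo_leq; [exact: prefix_refl|exact: prefix_trans|move=> n].
  by have [] := FP (n, _) (Xs n).
(* By [ss], [s i.+1] has more than [i] entries, so the default 0 is never read. *)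
pose h : baire := fun i => nth 0%N (s i.+1) i.
have sh n : initseg (s n) h.
  apply/initsegP => i isn; rewrite /h.
  have [/sp/prefixP[t ->]|/ltnW/sp/prefixP[t ->]] := leqP n i.+1.
    by rewrite nth_cat isn.
  by rewrite nth_cat ss.
by exists h => n _; have [_ _ _] := FP (n, _) (Xs n); apply; exact: (sh n.+1).
Qed.

Lemma Gdelta_setC (T : topologicalType) (S : set T) :
  Fsigma S -> Gdelta (~` S).
Proof.
move=> [F cF ->]; exists (fun n => ~` F n).
  by move=> n; exact: closed_openC.
by rewrite setC_bigcup.
Qed.

Lemma Delta02_S_infty (S : set baire) : Delta02 S -> S_infty S = set0.
Proof.
move=> [/Gdelta_setC[V oV CSV] [U oU SU]].
apply/eqP/negPn/negP => /eqP/eqP/set0P Sn0.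
(* Interleaving the two families makes a point of all the [W n] lie both in [S] and in its
   complement. *)
pose W n := if odd n then U n./2 else V n./2.
have [n|n x|//|h hW] := @baire_branches (S_infty S) W.
- by rewrite /W; case: ifP.
(* Stability at [alpha] gives each node branches on both sides of [S], whence density of every
   [W n]. *)
- rewrite /S_infty [X in X x -> _](alphaP S).1 stage_succ.
  move=> [_ [f [g [Xf Xg xf xg [Sf Sg]]]]]; rewrite /W; case: ifP => _.
    by exists f; split=> //; move: Sf; rewrite SU; exact.
  by exists g; split=> //; have : (~` S) g by []; rewrite CSV; exact.
have Sh : S h.
  rewrite SU => n _; have := hW n.*2.+1 I.
  by rewrite /W /= odd_double uphalf_double.
suff : (~` S) h by [].
by rewrite CSV => n _; have := hW n.*2 I; rewrite /W odd_double doubleK.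
Qed.

(** The least stage that omits [x] is neither stage zero, which is everything, nor a limit stage,
    which is an intersection; so it is a successor. *)
Lemma last_stage (S : set baire) (x : seq nat) : S_infty S = set0 ->
  exists b, stage S b x /\ ~ deriv S (stage S b) x.
Proof.
move=> S0.
have [|a [nax amin]] := @least_Ord (fun a => ~ stage S a x).
  by exists (alpha S); rewrite -/(S_infty S) S0.
have below b : (b < a)%O -> stage S b x.
  by move=> ba; apply: contrapT => /amin; rewrite leNgt ba.
have [a0|a0] := pselect (a = ozero).
  by case: nax; rewrite a0 stage0.
have [[b ab]|asucc] := pselect (exists b, a = osucc b).
  exists b; split; first by rewrite ab in below *; exact/below/lt_osucc.
  by rewrite -stage_succ -ab.
by exfalso; apply: nax; rewrite stage_limit.
Qed.

Lemma Fsigma_branches (X : seq nat -> set (seq nat)) (Q : set baire) :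
    (forall f, exists x, [/\ initseg x f, branches (X x) f &
       forall g, branches (X x) g -> initseg x g -> Q f -> Q g]) ->
  Fsigma Q.
Proof.
move=> XQ; pose N x := branches (X x) `&` initseg x.
exists (fun n => if unpickle n is Some x then
    if `[< N x `<=` Q >] then N x else set0 else set0).
  move=> n; case: unpickle => [x|]; last exact: closed0.
  case: ifP => _; last exact: closed0.
  by apply: closedI; [exact: closed_branches|exact: closed_initseg].
apply/seteqP; split=> [f Qf|f [n _]].
  have [x [xf Xf xQ]] := XQ f; exists (pickle x) => //.
  by rewrite pickleK; case: asboolP => // -[] g [Xg xg]; exact: (xQ g).
by case: unpickle => // x; case: asboolP => // NQ /NQ.
Qed.

Lemma S_infty_Delta02 (S : set baire) : S_infty S = set0 -> Delta02 S.
Proof.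
move=> S0; have [b bP] := choice (fun x => last_stage S x S0).
have point f : exists x, [/\ initseg x f, branches (stage S (b x)) f &
    forall g, branches (stage S (b x)) g -> initseg x g -> S f <-> S g].
  have [|_ [[n ->] bmin]] := @least_Ord (fun a => exists n, a = b (mkseq f n)).
    by exists (b (mkseq f 0)), 0%N.
  (* Any initial segment [x] of [f] lies in stage [b x], which is contained in the stage of the
     minimal index since stages decrease. *)
  have Xf : branches (stage S (b (mkseq f n))) f.
    move=> x xf; apply: (@stage_anti _ _ (b x)); last by have [] := bP x.
    by apply: bmin; exists (size x); rewrite -xf.
  exists (mkseq f n); split=> [||g Xg xg]; [exact: initseg_mkseq|exact: Xf|].
  (* Branches on opposite sides of [S] would put [mkseq f n] into the derivative. *)
  have [Xx nd] := bP (mkseq f n).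
  split=> [Sf|Sg]; apply: contrapT => nS; apply: nd; split=> //.
    by exists f, g; split=> //; exact: initseg_mkseq.
  by exists g, f; split=> //; exact: initseg_mkseq.
split; last (rewrite -[S]setCK; apply: Gdelta_setC).
all: apply: (@Fsigma_branches (fun x => stage S (b x))) => f.
all: have [x [xf Xf xS]] := point f; exists x; split=> // g Xg xg.
  by move/(xS g Xg xg).
by move=> nSf Sg; apply: nSf; apply/(xS g Xg xg).
Qed.

Theorem theorem9 (S : set baire) : Delta02 S <-> S_infty S = set0.
Proof. by split; [exact: Delta02_S_infty|exact: S_infty_Delta02]. Qed.
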